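(* Let $n>1$ and $k\ge 1$ be integers and let $r\in\mathbb{Z}_n$ be a residue class modulo $n$. Then $s(n,k,r)=w(X_n,k,0,r)$.
   Context: $\mathbb{U}_n$ is the group of units of the ring $\mathbb{Z}_n$ of integers modulo $n$. Define $$S(n,k,r)=\{(u_1,u_2,\dots,u_k)\in\mathbb{U}_n^k : u_1+u_2+\cdots+u_k\equiv r \bmod n\},\qquad s(n,k,r)=|S(n,k,r)|.$$ For an integer $n>1$, the unitary Cayley graph $X_n=\mathrm{Cay}(\mathbb{Z}_n,\mathbb{U}_n)$ is the undirected simple graph with vertex set $\mathbb{Z}_n=\{0,1,\dots,n-1\}$ in which $a$ and $b$ are adjacent if and only if $\gcd(a-b,n)=1$ (equivalently, $a-b\in\mathbb{U}_n$). For a graph $X$ and vertices $u,v$ (not necessarily distinct), a $u$-$v$ walk of length $k$ is an alternating sequence $u=u_0,e_1,u_1,\dots,e_k,u_k=v$ of vertices and edges with $e_i=u_{i-1}u_i$ an edge of $X$ for each $i$ (repetitions allowed); $w(X,k,u,v)$ denotes the number of $u$-$v$ walks of length $k$ in $X$. *)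

(* Defs.v *)
From HB Require Import structures.
From mathcomp Require Import all_boot all_order all_algebra.

Set Implicit Arguments.
Unset Strict Implicit.
Unset Printing Implicit Defensive.

Import GRing.Theory.

(* The notation 'Z_n denotes the ring of integers modulo n only when 1 < n
   ('Z_0 and 'Z_1 are both the integers modulo 2). *)

Definition unit_sums (n k : nat) (r : 'Z_n) : {set k.-tuple {unit 'Z_n}} :=
  [set u : k.-tuple {unit 'Z_n} |
    (\sum_(i < k) (val (tnth u i) : 'Z_n) == r)%R].

Definition s (n k : nat) (r : 'Z_n) : nat := #|unit_sums k r|.

Arguments unit_sums n k r : clear implicits.
Arguments s n k r : clear implicits.

Record sgraph := SGraph {
  vertex :> finType;
  adj : rel vertex;
  adj_sym : symmetric adj;
  adj_irrefl : irreflexive adj }.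

Definition edges (X : sgraph) : {set {set X}} :=
  [set e : {set X} | [exists x, exists y, adj x y && (e == [set x; y])]].

(* A walk is a pair (p, e) of its vertices p_0, ..., p_k and its edges, where
   the i-th component of e (counted from 0) joins p_i and p_(i+1):
   widen_ord (leqnSn k) i and lift ord0 i are i and i + 1 in 'I_k.+1. *)
Definition walks (X : sgraph) (k : nat) (u v : X) :
    {set k.+1.-tuple X * k.-tuple {set X}} :=
  [set pe : k.+1.-tuple X * k.-tuple {set X} |
    [&& tnth pe.1 ord0 == u, tnth pe.1 ord_max == v &
      [forall i : 'I_k,
        (tnth pe.2 i \in edges X) &&
        (tnth pe.2 i ==
          [set tnth pe.1 (widen_ord (leqnSn k) i); tnth pe.1 (lift ord0 i)])]]].

Definition w (X : sgraph) (k : nat) (u v : X) : nat := #|walks k u v|.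

Arguments w X k u v : clear implicits.

Section UnitaryCayley.

Variables (n : nat) (n_gt1 : 1 < n).

(* The gcd is that of the integers a - b and n, where a and b are identified
   with their representatives in {0, ..., n - 1}. *)
Definition unitary_cayley_adj : rel 'Z_n :=
  fun a b => gcdz ((a : nat)%:Z - (b : nat)%:Z)%R n == 1%R.

Lemma unitary_cayley_adj_sym : symmetric unitary_cayley_adj.
Proof. by move=> a b; rewrite /unitary_cayley_adj -opprB gcdNz. Qed.

Lemma unitary_cayley_adj_irrefl : irreflexive unitary_cayley_adj.
Proof.
move=> a; rewrite /unitary_cayley_adj subrr gcd0z.
by case: n n_gt1 => [|[|m]].
Qed.

Definition unitary_cayley : sgraph :=
  SGraph unitary_cayley_adj_sym unitary_cayley_adj_irrefl.

End UnitaryCayley.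

(* Main.v *)
Require Import Defs.
From mathcomp Require Import all_boot all_order all_algebra.

(** A walk from [0] to [r] is the trajectory of its steps: its [i]-th vertex
    is the sum of its first [i] steps, and a step from [a] to [b] is allowed
    exactly when [b - a] is a unit.  Hence taking partial sums turns the
    [k]-tuples of units with sum [r] into the vertex sequences of the walks of
    length [k] from [0] to [r]; the inverse takes differences of consecutive
    vertices.

    Three facts carry this.  In a simple graph the edges of a walk are forced
    by its vertices ([mem_walks]).  Partial sums and consecutive differences
    are mutually inverse, for sequences starting at [0] ([diff_partial_sums]
    and [partial_sums_diff]).  The gcd condition on representatives that
    defines adjacency is invertibility of the difference in the ring
    ([unitary_cayley_adjE]). *)

Set Implicit Arguments.
Unset Strict Implicit.
Unset Printing Implicit Defensive.

Import GRing.Theory.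
Local Open Scope ring_scope.

Section SimpleGraph.

Variable X : sgraph.

(** An unordered pair that is an edge determines its endpoints up to exchange,
    so symmetry makes adjacency independent of the chosen representation; the
    degenerate pairs are excluded by irreflexivity. *)
Lemma set2_edges (x y : X) : ([set x; y] \in edges X) = adj x y.
Proof.
rewrite inE; apply/existsP/idP => [[a /existsP[b /andP[ab /eqP xy]]]|xy]; last first.
  by exists x; apply/existsP; exists y; rewrite xy eqxx.
have := set22 a b; have := set21 a b; rewrite -xy !inE.
move=> /orP[]/eqP ax /orP[]/eqP bx; move: ab; rewrite ax bx ?adj_irrefl //.
by rewrite adj_sym.
Qed.

Definition walk_edges k (p : k.+1.-tuple X) : k.-tuple {set X} :=
  [tuple [set tnth p (widen_ord (leqnSn k) i); tnth p (lift ord0 i)] | i < k].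

Lemma mem_walks k (x y : X) (p : k.+1.-tuple X) (e : k.-tuple {set X}) :
  ((p, e) \in walks k x y) =
  [&& tnth p ord0 == x, tnth p ord_max == y, e == walk_edges p &
      [forall i : 'I_k,
        adj (tnth p (widen_ord (leqnSn k) i)) (tnth p (lift ord0 i))]].
Proof.
rewrite inE /=; congr [&& _, _ & _].
apply/forallP/andP => [step|[/eqP-> /forallP step] i]; last first.
  by rewrite tnth_mktuple eqxx set2_edges step.
split.
  apply/eqP/eq_from_tnth => i; rewrite tnth_mktuple.
  by have /andP[_ /eqP] := step i.
by apply/forallP => i; have /andP[+ /eqP ei] := step i; rewrite ei set2_edges.
Qed.

End SimpleGraph.

Section PartialSums.

Variables (V : zmodType) (k : nat).

Definition partial_sums (d : 'I_k -> V) : k.+1.-tuple V :=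
  [tuple \sum_(j < k | (j < i)%N) d j | i < k.+1].

Lemma partial_sums_first d : tnth (partial_sums d) ord0 = 0.
Proof. by rewrite tnth_mktuple big_pred0. Qed.

Lemma partial_sums_last d :
  tnth (partial_sums d) ord_max = \sum_(i < k) d i.
Proof. by rewrite tnth_mktuple; apply: eq_bigl => j; rewrite ltn_ord. Qed.

Lemma diff_partial_sums d i :
  tnth (partial_sums d) (lift ord0 i)
    - tnth (partial_sums d) (widen_ord (leqnSn k) i) = d i.
Proof.
rewrite !tnth_mktuple lift0 (bigD1 i) //= -[RHS]addr0 -addrA; congr (_ + _).
apply/eqP; rewrite subr_eq0; apply/eqP/eq_bigl => j.
by rewrite ltnS [RHS]ltn_neqAle andbC.
Qed.

(** Two sequences that start at the same point and have the same steps
    coincide, and [diff_partial_sums] computes the steps of the left side. *)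
Lemma partial_sums_diff (p : k.+1.-tuple V) :
  tnth p ord0 = 0 ->
  partial_sums
    (fun i => tnth p (lift ord0 i) - tnth p (widen_ord (leqnSn k) i)) = p.
Proof.
move=> p0; set d := fun i => _; apply: eq_from_tnth => -[m].
elim: m => [|m IHm] lt_m.
  have -> : Ordinal lt_m = ord0 by apply: val_inj.
  by rewrite partial_sums_first p0.
have lt_mk : (m < k)%N by [].
have -> : Ordinal lt_m = lift ord0 (Ordinal lt_mk) by apply: val_inj.
have := diff_partial_sums d (Ordinal lt_mk).
have -> : widen_ord (leqnSn k) (Ordinal lt_mk) = Ordinal (ltnW lt_m).
  exact: val_inj.
rewrite IHm /d => /(canRL (subrK _)) ->.
have -> : widen_ord (leqnSn k) (Ordinal lt_mk) = Ordinal (ltnW lt_m).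
  exact: val_inj.
by rewrite subrK.
Qed.

End PartialSums.

(** When [b <= a] the natural number [a - b] represents the ring difference,
    and a residue is a unit iff its representatives are coprime to [n].  Both
    sides are symmetric in [a] and [b], which gives the other case. *)
Lemma unitary_cayley_adjE n (n_gt1 : (1 < n)%N) (a b : 'Z_n) :
  unitary_cayley_adj a b = (a - b \is a GRing.unit).
Proof.
wlog le_ba : a b / (b <= a)%N => [IH|].
  have [/IH//|/ltnW/IH ba] := leqP b a.
  by rewrite unitary_cayley_adj_sym ba -opprB unitrN.
rewrite /unitary_cayley_adj subzn // -[a in RHS]natr_Zp -[b in RHS]natr_Zp.
by rewrite -natrB // unitZpE // coprime_sym.
Qed.

Section Trajectories.

Variables (n k : nat) (n_gt1 : (1 < n)%N).

Local Notation X := (unitary_cayley n_gt1).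

Definition trajectory (u : k.-tuple {unit 'Z_n}) :
    k.+1.-tuple X * k.-tuple {set X} :=
  let p : k.+1.-tuple X := partial_sums (fun i => val (tnth u i)) in
  (p, walk_edges p).

Lemma trajectory_inj : injective trajectory.
Proof.
move=> u v /(congr1 fst) /= eq_p; apply: eq_from_tnth => i; apply: val_inj.
rewrite -[LHS](diff_partial_sums (fun i => val (tnth u i))).
by rewrite eq_p diff_partial_sums.
Qed.

Lemma walks_trajectory (r : 'Z_n) :
  walks (X := X) k (0 : 'Z_n) r = trajectory @: unit_sums n k r.
Proof.
apply/setP => -[p e]; rewrite mem_walks.
apply/and4P/imsetP => [[/eqP p0 /eqP pr /eqP-> /forallP step]|[u]].
  pose d i : 'Z_n := tnth p (lift ord0 i) - tnth p (widen_ord (leqnSn k) i).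
  have d_unit i : d i \is a GRing.unit.
    by have := step i; rewrite adj_sym /= unitary_cayley_adjE.
  (* The default 1 is never taken: every step [d i] is a unit. *)
  pose u := [tuple insubd (1%g : {unit 'Z_n}) (d i) | i < k].
  have uE i : val (tnth u i) = d i by rewrite tnth_mktuple insubdK.
  have dp : partial_sums (fun i => val (tnth u i)) = p.
    rewrite -[RHS](partial_sums_diff p0).
    by apply: eq_mktuple => i; apply: eq_bigr => j _; apply: uE.
  exists u; last by rewrite /trajectory dp.
  by rewrite inE -(partial_sums_last (fun i => val (tnth u i))) dp pr.
rewrite inE => /eqP u_r [-> ->]; split=> //.
- by rewrite partial_sums_first.
- by rewrite partial_sums_last u_r.
apply/forallP => i; rewrite adj_sym /= unitary_cayley_adjE //.
by rewrite diff_partial_sums; apply: valP.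
Qed.

End Trajectories.

Local Close Scope ring_scope.

Theorem theorem5p1 (n k : nat) (n_gt1 : 1 < n) (k_gt0 : 0 < k) (r : 'Z_n) :
  s n k r = w (unitary_cayley n_gt1) k (0%R : 'Z_n) r.
Proof.
by rewrite /w walks_trajectory card_imset //; apply: trajectory_inj.
Qed.
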